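(* Let $E\in\{\mathscr D_a(\mathbb R),\mathscr D(\mathbb R)\}$ (with $a>0$), $U\in\mathcal N(E)$, $\gamma\in C(0)$ and $f\in E^{(\gamma,U)}$. For $\xi_0\in E$, $f_0\in E^{(\gamma,U)}$ and $\zeta\in E$ with $\int_{-\infty}^\infty\zeta(x)\,dx\ne0$ let $$g(\xi)=f_0\Big[\Big(\int_{-\infty}^\infty\xi(x)\,dx\Big)\xi_0\Big]+f\Big(-\int_{-\infty}^x\Big[\xi(\tau)-\frac{\int_{-\infty}^\infty\xi(s)\,ds}{\int_{-\infty}^\infty\zeta(s)\,ds}\zeta(\tau)\Big]\,d\tau\Big),\qquad\forall\,\xi\in E,$$ where the argument of $f$ is the test function of the variable $x\in\mathbb R$ given by the displayed expression. Then, for every such choice of $\xi_0,f_0,\zeta$, $g\in[E^{(\gamma,W)}]$ for some $W\in\mathcal N(E)$, and $g'=f$.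
   Context: Test function spaces on $\mathbb R$, over $\mathbb C$: for $a>0$, $\mathscr D_a(\mathbb R)$ is the Fréchet space of infinitely differentiable $\xi:\mathbb R\to\mathbb C$ with $\xi(x)=0$ for $|x|>a$, with norms $\|\xi\|_p=\sup_{|x|\le a}\max_{q\le p}|\xi^{(q)}(x)|$, $p=0,1,2,\dots$; $\mathscr D(\mathbb R)=\bigcup_{m\ge1}\mathscr D_m(\mathbb R)$ is the strict inductive limit. $\mathcal N(E)$ is the family of neighborhoods of $0$ in $E$. $C(0)$ is the set of functions $\gamma:\mathbb C\to\mathbb C$ with $\lim_{t\to0}\gamma(t)=\gamma(0)=0$ and $|\gamma(t)|\ge|t|$ for $|t|\le1$. For $\gamma\in C(0)$ and $U\in\mathcal N(E)$, $E^{(\gamma,U)}$ (demi-distributions) is the set of continuous $f:E\to\mathbb C$ with $f(0)=0$ such that for all $x\in E$, $u\in U$ and scalars $|t|\le1$ there are scalars $r,s$ with $|r-1|\le|\gamma(t)|$, $|s|\le|\gamma(t)|$ and $f(x+tu)=rf(x)+sf(u)$. $[E^{(\gamma,U)}]$ is the linear span of $E^{(\gamma,U)}$ in $\mathbb C^E$. The derivative of $y\in[E^{(\gamma,U)}]$ is $y':E\to\mathbb C$, $y'(\xi)=y(-\xi')$. *)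

(* Defs.v *)
From Stdlib Require Import Reals Lra Lia List.
From Stdlib Require Import FunctionalExtensionality ProofIrrelevance.
From Stdlib Require Import ssreflect.
From Coquelicot Require Import Coquelicot.

Open Scope R_scope.

(** For functions of a real variable, [C] is a normed module over [R]. *)
Definition ex_derivC (f : R -> C) (x : R) : Prop :=
  @ex_derive R_AbsRing C_R_NormedModule f x.

Definition is_derivC (f : R -> C) (x : R) (l : C) : Prop :=
  @is_derive R_AbsRing C_R_NormedModule f x l.

(** Meaningful where [ex_derivC f x] holds: see [derivC_correct]. *)
Definition derivC (f : R -> C) (x : R) : C :=
  (Derive (fun t => Re (f t)) x, Derive (fun t => Im (f t)) x).

Fixpoint derivC_n (f : R -> C) (q : nat) : R -> C :=
  match q with
  | O => f
  | S q => derivC (derivC_n f q)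
  end.

Definition smooth (f : R -> C) : Prop :=
  forall (q : nat) (x : R), ex_derivC (derivC_n f q) x.

Lemma is_derivC_linear (L : C -> C) (f : R -> C) (x : R) (l : C) :
  @is_linear R_AbsRing C_R_NormedModule C_R_NormedModule L ->
  is_derivC f x l -> is_derivC (fun t => L (f t)) x (L l).
Proof.
move=> HL H.
have H1 := filterdiff_comp' (K:=R_AbsRing) (U:=R_NormedModule)
  (V:=C_R_NormedModule) (W:=C_R_NormedModule) f L x _ L H
  (@filterdiff_linear R_AbsRing C_R_NormedModule C_R_NormedModule _ L HL).
apply: (filterdiff_ext_lin (U := R_NormedModule) (V := C_R_NormedModule) _ _ _ H1) => y.
exact: (@linear_scal R_AbsRing C_R_NormedModule C_R_NormedModule L HL).
Qed.

Lemma is_derivC_unique (f : R -> C) (x : R) (l : C) :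
  is_derivC f x l -> derivC f x = l.
Proof.
move=> H; rewrite (surjective_pairing l) /derivC; congr pair; apply: is_derive_unique.
- have H1 := filterdiff_comp' (K:=R_AbsRing) (U:=R_NormedModule)
    (V:=C_R_NormedModule) (W:=R_NormedModule) f (fun z : C => fst z) x _
    (fun z : C => fst z) H (@filterdiff_linear R_AbsRing C_R_NormedModule R_NormedModule _ _
      (@is_linear_fst R_AbsRing R_NormedModule R_NormedModule)).
  exact: (filterdiff_ext_lin (U := R_NormedModule) (V := R_NormedModule) _ _ _ H1).
- have H1 := filterdiff_comp' (K:=R_AbsRing) (U:=R_NormedModule)
    (V:=C_R_NormedModule) (W:=R_NormedModule) f (fun z : C => snd z) x _
    (fun z : C => snd z) H (@filterdiff_linear R_AbsRing C_R_NormedModule R_NormedModule _ _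
      (@is_linear_snd R_AbsRing R_NormedModule R_NormedModule)).
  exact: (filterdiff_ext_lin (U := R_NormedModule) (V := R_NormedModule) _ _ _ H1).
Qed.

Lemma derivC_correct (f : R -> C) (x : R) :
  ex_derivC f x -> is_derivC f x (derivC f x).
Proof. by move=> [l Hl]; rewrite (is_derivC_unique _ _ _ Hl). Qed.

Lemma is_linear_Cmult (c : C) :
  @is_linear R_AbsRing C_R_NormedModule C_R_NormedModule (Cmult c).
Proof.
split.
- move=> u v. exact: Cmult_plus_distr_l.
- move=> k u; rewrite !scal_R_Cmult !Cmult_assoc (Cmult_comm c). by [].
- exists (Cmod c + 1); split; first by have := Cmod_ge_0 c; lra.
  move=> z.
  have -> : norm (V := C_R_NormedModule) (Cmult c z) = Cmod c * Cmod z.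
    by rewrite -Cmod_mult Cmod_norm.
  rewrite -Cmod_norm.
  have := Cmod_ge_0 z; nra.
Qed.

Lemma derivC_plus (f g : R -> C) : smooth f -> smooth g -> forall q,
  derivC_n (fun x => Cplus (f x) (g x)) q =
  (fun x => Cplus (derivC_n f q x) (derivC_n g q x)).
Proof.
move=> Hf Hg; elim=> [|q /= ->] //.
apply: functional_extensionality => x; apply: is_derivC_unique.
apply: (is_derive_plus (V := C_R_NormedModule)); exact: derivC_correct.
Qed.

Lemma derivC_scal (c : C) (f : R -> C) : smooth f -> forall q,
  derivC_n (fun x => Cmult c (f x)) q = (fun x => Cmult c (derivC_n f q x)).
Proof.
move=> Hf; elim=> [|q /= ->] //.
apply: functional_extensionality => x; apply: is_derivC_unique.
apply: (is_derivC_linear (Cmult c)); [exact: is_linear_Cmult | exact: derivC_correct].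
Qed.

Lemma derivC_zero (q : nat) : derivC_n (fun _ => RtoC 0) q = (fun _ => RtoC 0).
Proof.
elim: q => [|q /= ->] //.
apply: functional_extensionality => x; apply: is_derivC_unique.
exact: (is_derive_const (V := C_R_NormedModule)).
Qed.

Lemma smooth_plus (f g : R -> C) :
  smooth f -> smooth g -> smooth (fun x => Cplus (f x) (g x)).
Proof.
move=> Hf Hg q x; rewrite derivC_plus //.
apply: (ex_derive_plus (V := C_R_NormedModule)); [exact: Hf | exact: Hg].
Qed.

Lemma smooth_scal (c : C) (f : R -> C) : smooth f -> smooth (fun x => Cmult c (f x)).
Proof.
move=> Hf q x; rewrite derivC_scal //; exists (Cmult c (derivC (derivC_n f q) x)).
apply: (is_derivC_linear (Cmult c)); [exact: is_linear_Cmult | exact: derivC_correct].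
Qed.

Lemma smooth_zero : smooth (fun _ => RtoC 0).
Proof. move=> q x; rewrite derivC_zero; exact: (ex_derive_const (V := C_R_NormedModule)). Qed.

Lemma derivC_n_shift (f : R -> C) (q : nat) : derivC_n (derivC f) q = derivC_n f (S q).
Proof. by elim: q => [|q /= ->]. Qed.

Lemma smooth_derivC (f : R -> C) : smooth f -> smooth (derivC f).
Proof. move=> Hf q; rewrite derivC_n_shift; exact: Hf (S q). Qed.

Lemma smooth_primitive (F f : R -> C) :
  smooth f -> (forall x, is_derivC F x (f x)) -> smooth F.
Proof.
move=> Hf HF.
have E : derivC F = f by apply: functional_extensionality => x; exact: is_derivC_unique.
case=> [|q] x; first by exists (f x); exact: HF.
rewrite -derivC_n_shift E; exact: Hf.
Qed.

Lemma smooth_continuous (f : R -> C) (q : nat) (x : R) :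
  smooth f -> @continuous R_UniformSpace C_R_NormedModule (derivC_n f q) x.
Proof. move=> Hf; exact: (ex_derive_continuous (V := C_R_NormedModule)) (Hf q x). Qed.

Lemma derivC_local_zero (a : R) (f : R -> C) :
  (forall x, a < Rabs x -> f x = 0) -> forall x, a < Rabs x -> derivC f x = 0.
Proof.
move=> Hf x Hx; apply: is_derivC_unique.
apply: (is_derive_ext_loc (V := C_R_NormedModule) (fun _ => RtoC 0)); last first.
  exact: (is_derive_const (V := C_R_NormedModule)).
have Hd : 0 < Rabs x - a by lra.
exists (mkposreal _ Hd) => y Hy; symmetry; apply: Hf.
have : Rabs (y - x) < Rabs x - a := Hy.
have := Rabs_triang_inv x (x - y); rewrite (Rabs_minus_sym y x).
have -> : x - (x - y) = y by ring.
lra.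
Qed.

Definition integral (f : R -> C) : C :=
  RInt_gen (V := C_R_CompleteNormedModule) f (Rbar_locally m_infty) (Rbar_locally p_infty).

Definition integral_upto (f : R -> C) (x : R) : C :=
  RInt_gen (V := C_R_CompleteNormedModule) f (Rbar_locally m_infty) (at_point x).

Definition vanishes_outside (a : R) (f : R -> C) : Prop :=
  forall x, a < Rabs x -> f x = 0.

Lemma is_RInt_gen_eventually (f : R -> C) (Fa Fb : (R -> Prop) -> Prop) (l : C) :
  Filter Fa -> Filter Fb ->
  filter_prod Fa Fb (fun ab =>
    is_RInt (V := C_R_NormedModule) f (fst ab) (snd ab) l) ->
  is_RInt_gen (V := C_R_NormedModule) f Fa Fb l.
Proof.
move=> FFa FFb H P HP; apply: filter_imp H => ab Hab.
exists l; split=> //; exact: locally_singleton.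
Qed.

Lemma is_RInt_zero (f : R -> C) (a b : R) :
  (forall x, Rmin a b < x < Rmax a b -> f x = 0) ->
  is_RInt (V := C_R_NormedModule) f a b (RtoC 0).
Proof.
move=> H; have := is_RInt_const (V := C_R_NormedModule) a b (RtoC 0).
rewrite (scal_zero_r (V := C_R_NormedModule)) => H1.
apply: (is_RInt_ext (V := C_R_NormedModule)) H1 => x Hx; by rewrite H.
Qed.

Lemma is_RInt_smooth (f : R -> C) (a b : R) : smooth f ->
  is_RInt (V := C_R_NormedModule) f a b (RInt (V := C_R_CompleteNormedModule) f a b).
Proof.
move=> Hf; apply: (RInt_correct (V := C_R_CompleteNormedModule)).
apply: (ex_RInt_continuous (V := C_R_CompleteNormedModule)) => z _.
exact: (smooth_continuous f 0).
Qed.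

Lemma is_RInt_left (b : R) (f : R -> C) (Hb : 0 <= b) (Hf : smooth f) (Hs : vanishes_outside b f)
    (a x : R) : a < - b ->
  is_RInt (V := C_R_NormedModule) f a x (RInt (V := C_R_CompleteNormedModule) f (- b) x).
Proof.
move=> Ha.
rewrite -[RInt _ _ _](plus_zero_l (G := C_R_NormedModule)).
apply: (is_RInt_Chasles (V := C_R_NormedModule)) (is_RInt_smooth f _ _ Hf).
apply: is_RInt_zero => y; rewrite Rmin_left ?Rmax_right; try lra.
move=> Hy; apply: Hs; rewrite Rabs_left; lra.
Qed.

Lemma is_integral_upto (b : R) (f : R -> C) (Hb : 0 <= b) (Hf : smooth f) (Hs : vanishes_outside b f)
    (x : R) :
  is_RInt_gen (V := C_R_NormedModule) f (Rbar_locally m_infty) (at_point x)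
    (RInt (V := C_R_CompleteNormedModule) f (- b) x).
Proof.
apply: is_RInt_gen_eventually.
apply: (Filter_prod _ _ _ (fun a => a < - b) (fun y => y = x)) => //.
- by exists (- b).
- by move=> a y Ha -> /=; exact: is_RInt_left.
Qed.

Lemma is_integral (b : R) (f : R -> C) (Hb : 0 <= b) (Hf : smooth f) (Hs : vanishes_outside b f)
    :
  is_RInt_gen (V := C_R_NormedModule) f (Rbar_locally m_infty) (Rbar_locally p_infty)
    (RInt (V := C_R_CompleteNormedModule) f (- b) b).
Proof.
apply: is_RInt_gen_eventually.
apply: (Filter_prod _ _ _ (fun a => a < - b) (fun y => b < y)) => //.
- by exists (- b).
- by exists b.
- move=> a y Ha Hy /=.
  rewrite -[RInt _ _ _](plus_zero_r (G := C_R_NormedModule)).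
  apply: (is_RInt_Chasles (V := C_R_NormedModule)) (is_RInt_left b f Hb Hf Hs a b Ha) _.
  apply: is_RInt_zero => z; rewrite Rmin_left ?Rmax_right; try lra.
  move=> Hz; apply: Hs; rewrite Rabs_right; lra.
Qed.

Lemma integral_uptoE (b : R) (f : R -> C) (Hb : 0 <= b) (Hf : smooth f) (Hs : vanishes_outside b f)
    (x : R) :
  integral_upto f x = RInt (V := C_R_CompleteNormedModule) f (- b) x.
Proof.
exact: (is_RInt_gen_unique (V := C_R_CompleteNormedModule) f _
  (is_integral_upto b f Hb Hf Hs x)).
Qed.

Lemma integralE (b : R) (f : R -> C) (Hb : 0 <= b) (Hf : smooth f) (Hs : vanishes_outside b f)
    : integral f = RInt (V := C_R_CompleteNormedModule) f (- b) b.
Proof.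
exact: (is_RInt_gen_unique (V := C_R_CompleteNormedModule) f _
  (is_integral b f Hb Hf Hs)).
Qed.

Lemma is_derivC_integral_upto (b : R) (f : R -> C) (Hb : 0 <= b) (Hf : smooth f) (Hs : vanishes_outside b f)
    (x : R) : is_derivC (integral_upto f) x (f x).
Proof.
apply: (is_derive_ext (V := C_R_NormedModule)
  (RInt (V := C_R_CompleteNormedModule) f (- b))).
  by move=> t; rewrite (integral_uptoE b f Hb Hf Hs).
apply: (is_derive_RInt (V := C_R_NormedModule) f _ (- b)).
  apply: filter_forall => t; exact: is_RInt_smooth.
exact: (smooth_continuous f 0).
Qed.

Lemma smooth_integral_upto (b : R) (f : R -> C) (Hb : 0 <= b) (Hf : smooth f) (Hs : vanishes_outside b f)
    : smooth (integral_upto f).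
Proof. apply: (smooth_primitive _ f) => // x; exact: (is_derivC_integral_upto b). Qed.

Lemma vanishes_integral_upto (b : R) (f : R -> C) (Hb : 0 <= b) (Hf : smooth f) (Hs : vanishes_outside b f)
    : integral f = 0 -> vanishes_outside b (integral_upto f).
Proof.
move=> H0 x Hx; rewrite (integral_uptoE b f Hb Hf Hs).
have [Hx0|Hx0] := Rle_dec 0 x.
- rewrite -H0 (integralE b f Hb Hf Hs).
  apply: (is_RInt_unique (V := C_R_CompleteNormedModule)).
  rewrite -[RInt _ _ b](plus_zero_r (G := C_R_NormedModule)).
  apply: (is_RInt_Chasles (V := C_R_NormedModule)) (is_RInt_smooth f _ _ Hf) _.
  rewrite Rabs_right in Hx; last lra.
  apply: is_RInt_zero => z; rewrite Rmin_left ?Rmax_right; try lra.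
  move=> Hz; apply: Hs; rewrite Rabs_right; lra.
- apply: (is_RInt_unique (V := C_R_CompleteNormedModule)).
  rewrite Rabs_left in Hx; last lra.
  apply: is_RInt_zero => z; rewrite Rmin_right ?Rmax_left; try lra.
  move=> Hz; apply: Hs; rewrite Rabs_left; lra.
Qed.
Lemma integral_centred (b : R) (f g : R -> C) : 0 <= b ->
  smooth f -> vanishes_outside b f -> smooth g -> vanishes_outside b g ->
  integral g <> 0 ->
  integral (fun x => Cplus (f x) (Cmult (Copp (Cdiv (integral f) (integral g))) (g x))) = 0.
Proof.
move=> Hb Hf Hsf Hg Hsg Hg0.
set c := Copp _.
have Hcg := smooth_scal c g Hg.
have Hh := smooth_plus _ _ Hf Hcg.
have Hsh : vanishes_outside b (fun x => Cplus (f x) (Cmult c (g x))).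
  by move=> x Hx; rewrite Hsf // Hsg // Cmult_0_r Cplus_0_l.
rewrite (integralE b) //; apply: (is_RInt_unique (V := C_R_CompleteNormedModule)).
pose G := integral_upto g.
have HI : is_RInt (V := C_R_NormedModule) (fun x => Cmult c (g x)) (- b) b
    (minus (G := C_R_NormedModule) (Cmult c (G b)) (Cmult c (G (- b)))).
  apply: (is_RInt_derive (V := C_R_CompleteNormedModule)
    (fun x => Cmult c (G x)) (fun x => Cmult c (g x))).
  - move=> x _; apply: (is_derivC_linear (Cmult c)); first exact: is_linear_Cmult.
    exact: (is_derivC_integral_upto b).
  - move=> x _; exact: (smooth_continuous _ 0).
have EG0 : G (- b) = 0.
  rewrite /G (integral_uptoE b) //.
  exact: (RInt_point (V := C_R_CompleteNormedModule)).
have EGb : G b = integral g by rewrite /G (integral_uptoE b) // (integralE b).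
have := is_RInt_plus (V := C_R_NormedModule) _ _ _ _ _ _
  (is_RInt_smooth f (- b) b Hf) HI.
rewrite EG0 EGb -(integralE b) //.
have -> : plus (G := C_R_NormedModule) (integral f)
   (minus (G := C_R_NormedModule) (Cmult c (integral g)) (Cmult c 0)) = RtoC 0; last by [].
rewrite /minus.
change (integral f + (c * integral g + - (c * 0)) = 0)%C.
rewrite /c; field. exact: Hg0.
Qed.

(** Codes for the spaces 𝒟_a(ℝ) and 𝒟(ℝ); their elements form [test E]. *)
Inductive space : Type :=
  | D_ (a : posreal)
  | D.

Lemma INR_plus_1_pos (m : nat) : 0 < INR m + 1.
Proof. have := pos_INR m; lra. Qed.

(** The integers [m + 1 >= 1], as radii. *)
Definition radius (m : nat) : posreal := mkposreal (INR m + 1) (INR_plus_1_pos m).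

Definition supported (E : space) (f : R -> C) : Prop :=
  match E with
  | D_ a => vanishes_outside a f
  | D => exists m : nat, vanishes_outside (radius m) f
  end.

Record test (E : space) : Type := Test {
  test_fun :> R -> C;
  test_smooth : smooth test_fun;
  test_supported : supported E test_fun
}.

Arguments Test {E}.
Arguments test_smooth {E}.
Arguments test_supported {E}.

Lemma test_eq (E : space) (xi eta : test E) : (forall x, xi x = eta x) -> xi = eta.
Proof.
case: xi eta => [f Hf Sf] [g Hg Sg] /= H.
have Hfg : f = g by apply: functional_extensionality.
case: _ / Hfg in Hg Sg H *.
by rewrite (proof_irrelevance _ Hf Hg) (proof_irrelevance _ Sf Sg).
Qed.

Lemma common_bound (E : space) (f g : R -> C) : supported E f -> supported E g ->
  exists b : R, 0 <= b /\ vanishes_outside b f /\ vanishes_outside b g /\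
    forall h, vanishes_outside b h -> supported E h.
Proof.
case: E => [a|] /=.
- by move=> Hf Hg; exists a; have := cond_pos a; repeat split=> //; lra.
- move=> [m Hf] [n Hg]; exists (radius (max m n)).
  have Hm : radius m <= radius (max m n).
    by apply: Rplus_le_compat_r; apply: le_INR; lia.
  have Hn : radius n <= radius (max m n).
    by apply: Rplus_le_compat_r; apply: le_INR; lia.
  split; [|split; [|split]].
  + by have := cond_pos (radius (max m n)); lra.
  + by move=> x Hx; apply: Hf; exact: Rle_lt_trans Hm Hx.
  + by move=> x Hx; apply: Hg; exact: Rle_lt_trans Hn Hx.
  + by move=> h Hh; exists (max m n).
Qed.

Lemma supported_zero (E : space) : supported E (fun _ => RtoC 0).
Proof. by case: E => [a|] /=; [|exists O]. Qed.

Lemma supported_plus (E : space) (f g : R -> C) :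
  supported E f -> supported E g -> supported E (fun x => Cplus (f x) (g x)).
Proof.
move=> Hf Hg; have [b [_ [Hbf [Hbg HE]]]] := common_bound E f g Hf Hg.
by apply: HE => x Hx; rewrite Hbf // Hbg // Cplus_0_l.
Qed.

Lemma supported_scal (E : space) (c : C) (f : R -> C) :
  supported E f -> supported E (fun x => Cmult c (f x)).
Proof.
move=> Hf; have [b [_ [Hbf [_ HE]]]] := common_bound E f f Hf Hf.
by apply: HE => x Hx; rewrite Hbf // Cmult_0_r.
Qed.

Lemma supported_derivC (E : space) (f : R -> C) : supported E f -> supported E (derivC f).
Proof.
move=> Hf; have [b [_ [Hbf [_ HE]]]] := common_bound E f f Hf Hf.
apply: HE; exact: derivC_local_zero.
Qed.

Lemma Copp_scal (z : C) : Copp z = Cmult (Copp 1) z.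
Proof. ring. Qed.

Lemma smooth_opp (f : R -> C) : smooth f -> smooth (fun x => Copp (f x)).
Proof.
move=> Hf.
rewrite (functional_extensionality _ _ (fun x => Copp_scal (f x))).
exact: smooth_scal.
Qed.

Lemma supported_opp (E : space) (f : R -> C) :
  supported E f -> supported E (fun x => Copp (f x)).
Proof.
move=> Hf.
rewrite (functional_extensionality _ _ (fun x => Copp_scal (f x))).
exact: supported_scal.
Qed.

Definition test_zero (E : space) : test E := Test _ smooth_zero (supported_zero E).

Definition test_plus {E : space} (xi eta : test E) : test E :=
  Test _ (smooth_plus _ _ (test_smooth xi) (test_smooth eta))
    (supported_plus E _ _ (test_supported xi) (test_supported eta)).

Definition test_opp {E : space} (xi : test E) : test E :=
  Test _ (smooth_opp _ (test_smooth xi)) (supported_opp E _ (test_supported xi)).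

Definition test_scal {E : space} (c : C) (xi : test E) : test E :=
  Test _ (smooth_scal c _ (test_smooth xi)) (supported_scal E c _ (test_supported xi)).

Lemma test_plus_comm (E : space) (xi eta : test E) : test_plus xi eta = test_plus eta xi.
Proof. by apply: test_eq => x; apply: Cplus_comm. Qed.

Lemma test_plus_assoc (E : space) (xi eta theta : test E) :
  test_plus xi (test_plus eta theta) = test_plus (test_plus xi eta) theta.
Proof. by apply: test_eq => x; apply: Cplus_assoc. Qed.

Lemma test_plus_zero_r (E : space) (xi : test E) : test_plus xi (test_zero E) = xi.
Proof. by apply: test_eq => x; apply: Cplus_0_r. Qed.

Definition test_AbelianMonoid_mixin (E : space) :=
  AbelianMonoid.Mixin (test E) test_plus (test_zero E)
    (test_plus_comm E) (test_plus_assoc E) (test_plus_zero_r E).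

Canonical test_AbelianMonoid (E : space) :=
  AbelianMonoid.Pack (test E) (test_AbelianMonoid_mixin E) (test E).

Lemma test_plus_opp_r (E : space) (xi : test E) : plus xi (test_opp xi) = zero.
Proof. by apply: test_eq => x; apply: Cplus_opp_r. Qed.

Definition test_AbelianGroup_mixin (E : space) :=
  AbelianGroup.Mixin (test_AbelianMonoid E) test_opp (test_plus_opp_r E).

Canonical test_AbelianGroup (E : space) :=
  AbelianGroup.Pack (test E)
    (AbelianGroup.Class _ (test_AbelianMonoid_mixin E) (test_AbelianGroup_mixin E)) (test E).

Lemma test_scal_assoc (E : space) (x y : C) (u : test E) :
  test_scal x (test_scal y u) = test_scal (mult x y) u.
Proof. by apply: test_eq => t; apply: Cmult_assoc. Qed.

Lemma test_scal_one (E : space) (u : test E) : test_scal (one : C_Ring) u = u.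
Proof. by apply: test_eq => t; apply: Cmult_1_l. Qed.

Lemma test_scal_plus_l (E : space) (x : C) (u v : test E) :
  test_scal x (plus u v) = plus (test_scal x u) (test_scal x v).
Proof. by apply: test_eq => t; apply: Cmult_plus_distr_l. Qed.

Lemma test_scal_plus_r (E : space) (x y : C) (u : test E) :
  test_scal (plus x y) u = plus (test_scal x u) (test_scal y u).
Proof. by apply: test_eq => t; apply: Cmult_plus_distr_r. Qed.

Definition test_ModuleSpace_mixin (E : space) :=
  ModuleSpace.Mixin C_Ring (test_AbelianGroup E) test_scal (test_scal_assoc E)
    (test_scal_one E) (test_scal_plus_l E) (test_scal_plus_r E).

Canonical test_ModuleSpace (E : space) :=
  ModuleSpace.Pack C_Ring (test E)
    (ModuleSpace.Class _ _ _ (test_ModuleSpace_mixin E)) (test E).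

Fixpoint max_derivC (f : R -> C) (p : nat) (x : R) : R :=
  match p with
  | O => Cmod (f x)
  | S p' => Rmax (max_derivC f p' x) (Cmod (derivC_n f p x))
  end.

(** The least upper bound is finite on smooth functions: see [norm_D_is_lub]. *)
Definition norm_D (a : R) (p : nat) (f : R -> C) : R :=
  real (Lub_Rbar (fun y => exists x, Rabs x <= a /\ y = max_derivC f p x)).

Lemma max_derivC_bounded (a : posreal) (p : nat) (f : R -> C) : smooth f ->
  exists M, forall x, Rabs x <= a -> max_derivC f p x <= M.
Proof.
move=> Hf.
have HB q : exists M, forall x, Rabs x <= a -> Cmod (derivC_n f q x) <= M.
  have Ha := cond_pos a.
  have [|x _|x0 [Hx0 _]] := continuity_ab_maj (fun x => Cmod (derivC_n f q x)) (- a) a.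
  - lra.
  - apply/continuity_pt_filterlim.
    apply: (filterlim_ext (fun x => norm (V := C_R_NormedModule) (derivC_n f q x))).
      by move=> y; rewrite Cmod_norm.
    rewrite Cmod_norm.
    apply: (filterlim_comp _ _ _ _ _ _ _ _ (smooth_continuous f q x Hf)).
    exact: (filterlim_norm (V := C_R_NormedModule)).
  - exists (Cmod (derivC_n f q x0)) => x Hx; apply: Hx0.
    by apply/Rabs_le_between.
elim: p => [|p [M HM]] /=; first exact: HB O.
have [N HN] := HB (S p).
exists (Rmax M N) => x Hx.
by apply: Rmax_lub; [apply: Rle_trans (HM x Hx) (Rmax_l _ _)
                    | apply: Rle_trans (HN x Hx) (Rmax_r _ _)].
Qed.

Lemma norm_D_is_lub (a : posreal) (p : nat) (f : R -> C) : smooth f ->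
  is_lub (fun y => exists x, Rabs x <= a /\ y = max_derivC f p x) (norm_D a p f).
Proof.
move=> Hf; rewrite /norm_D; set S := fun y => _.
have [M HM] := max_derivC_bounded a p f Hf.
have H := Lub_Rbar_correct S; case: (Lub_Rbar S) H => [l| |] [H1 H2] /=.
- split; first exact: H1.
  by move=> b Hb; apply: (H2 b).
- by have /= := H2 M; case=> y [x [Hx ->]]; exact: HM.
- have /= := H1 (max_derivC f p 0); case; exists 0; split=> //.
  rewrite Rabs_R0; have := cond_pos a; lra.
Qed.

Definition test_incl (m : nat) (xi : test (D_ (radius m))) : test D :=
  @Test D xi (test_smooth xi)
    (ex_intro (fun m => vanishes_outside (radius m) xi) m (test_supported xi)).

Definition convex {E : space} (V : test E -> Prop) : Prop :=
  forall (xi eta : test E) (t : R), 0 <= t <= 1 -> V xi -> V eta ->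
    V (plus (scal (RtoC (1 - t)) xi) (scal (RtoC t) eta)).

Definition balanced {E : space} (V : test E -> Prop) : Prop :=
  forall (xi : test E) (c : C), Cmod c <= 1 -> V xi -> V (scal c xi).

(** Neighborhoods of [0]. In [D], a base is formed by the convex balanced sets
    whose trace on each 𝒟_m(ℝ) is a neighborhood of [0]: this is the finest locally
    convex topology for which all the inclusions are continuous (such sets are
    absorbing since [D] is the union of the 𝒟_m(ℝ)). *)
Definition nbhs0 (E : space) : (test E -> Prop) -> Prop :=
  match E with
  | D_ a => fun V => exists (p : nat) (eps : posreal),
      forall xi : test (D_ a), norm_D a p xi < eps -> V xi
  | D => fun V => exists W : test D -> Prop,
      convex W /\ balanced W /\
      (forall m : nat, exists (p : nat) (eps : posreal),
        forall xi : test (D_ (radius m)),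
          norm_D (radius m) p xi < eps -> W (test_incl m xi)) /\
      (forall xi : test D, W xi -> V xi)
  end.

Definition nbhs {E : space} (xi : test E) (V : test E -> Prop) : Prop :=
  nbhs0 E (fun h => V (plus xi h)).

Definition continuous_functional {E : space} (f : test E -> C) : Prop :=
  forall xi : test E, filterlim f (nbhs xi) (locally (f xi)).

(** The class C(0); no continuity away from [0] is required. *)
Definition C0 (gamma : C -> C) : Prop :=
  filterlim gamma (locally' (RtoC 0)) (locally (gamma 0)) /\ gamma 0 = 0 /\
  forall t : C, Cmod t <= 1 -> Cmod t <= Cmod (gamma t).

Definition demi_distribution {E : space} (gamma : C -> C) (U : test E -> Prop)
    (f : test E -> C) : Prop :=
  continuous_functional f /\ f zero = 0 /\
  forall (x u : test E) (t : C), U u -> Cmod t <= 1 ->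
    exists r s : C,
      Cmod (r - 1) <= Cmod (gamma t) /\ Cmod s <= Cmod (gamma t) /\
      f (plus x (scal t u)) = (r * f x + s * f u)%C.

Definition linear_span {T : Type} (S : (T -> C) -> Prop) (y : T -> C) : Prop :=
  exists l : list (C * (T -> C)),
    List.Forall (fun cf => S (snd cf)) l /\
    forall x : T, y x = fold_right (fun cf z => (fst cf * snd cf x + z)%C) (RtoC 0) l.

Definition test_deriv {E : space} (xi : test E) : test E :=
  Test _ (smooth_derivC _ (test_smooth xi)) (supported_derivC E _ (test_supported xi)).

Definition derivative {E : space} (y : test E -> C) : test E -> C :=
  fun xi => y (opp (test_deriv xi)).

Definition centred_primitive (zeta xi : R -> C) : R -> C := fun x =>
  (- integral_upto (fun tau => xi tau - integral xi / integral zeta * zeta tau) x)%C.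

Lemma centred_primitive_test (E : space) (zeta xi : test E) : integral zeta <> 0 ->
  smooth (centred_primitive zeta xi) /\ supported E (centred_primitive zeta xi).
Proof.
move=> Hz.
have [b [Hb [Hxi [Hzeta HE]]]] := common_bound E xi zeta (test_supported xi) (test_supported zeta).
rewrite /centred_primitive.
set c := Cdiv _ _.
pose h := fun tau => Cplus (xi tau) (Cmult (Copp c) (zeta tau)).
have -> : (fun tau => xi tau - c * zeta tau)%C = h.
  apply: functional_extensionality => tau; rewrite /h; ring.
have Hh : smooth h.
  apply: smooth_plus; [|apply: smooth_scal]; exact: test_smooth.
have Hsh : vanishes_outside b h.
  by move=> x Hx; rewrite /h Hxi // Hzeta // Cmult_0_r Cplus_0_l.
have H0 : integral h = 0.
  apply: (integral_centred b) => //; exact: test_smooth.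
split.
- apply: smooth_opp; exact: (smooth_integral_upto b).
- apply: supported_opp; apply: HE; exact: vanishes_integral_upto.
Qed.

Definition centred_primitive_of {E : space} (zeta : test E) (Hzeta : integral zeta <> 0)
    (xi : test E) : test E :=
  Test (centred_primitive zeta xi)
    (proj1 (centred_primitive_test E zeta xi Hzeta))
    (proj2 (centred_primitive_test E zeta xi Hzeta)).

(* Main.v *)
Require Import Defs.
From Stdlib Require Import Reals.
From Coquelicot Require Import Coquelicot.
From Stdlib Require Import Lra Lia List FunctionalExtensionality ssreflect.

(** Put T1 xi = (∫ xi) xi0 and T2 xi = the centred primitive of xi, so that
    g = f0 ∘ T1 + f ∘ T2. Both T1 and T2 are continuous linear maps from E to itself.
    The demi-linearity identity f (x + t u) = r f x + s f u survives composition with a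
    linear map T, since T (x + t u) = T x + t T u; only the range of u changes, from U
    to its preimage under T, which is a neighbourhood of 0 when T is continuous
    ([demi_distribution_comp]). So both terms of g are demi-distributions for
    W = T1⁻¹(U) ∩ T2⁻¹(U), with the same gamma, and g lies in their span.

    The equation g' = f holds because T1 and T2 are evaluated at - xi', whose integral is
    0: the first term is then f0 0 = 0, and T2 (- xi') = xi.

    Everything about T2 is read off its derivative, - xi + (∫ xi / ∫ zeta) zeta
    ([test_deriv_centred_primitive]), since a compactly supported function is determined
    by its derivative ([test_deriv_inj]): this gives linearity and T2 (- xi') = xi. Its
    continuity comes from the Poincaré inequality ([poincare]), which bounds a function
    supported in [-b, b], with its derivatives, by its derivative. *)

(** * Integrals of test functions *)

Lemma smooth_is_derivC (F : R -> C) (x : R) : smooth F -> is_derivC F x (derivC F x).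
Proof. move=> HF; exact: derivC_correct (HF O x). Qed.

Lemma is_RInt_of_primitive (F f : R -> C) (u v : R) :
  smooth f -> (forall x, is_derivC F x (f x)) ->
  is_RInt (V := C_R_NormedModule) f u v (F v - F u)%C.
Proof.
move=> Hf HF; apply: (is_RInt_derive (V := C_R_CompleteNormedModule) F f).
- by move=> x _; exact: HF.
- by move=> x _; exact: (smooth_continuous f 0).
Qed.

Lemma integral_of_primitive (b : R) (F f : R -> C) : 0 <= b ->
  smooth f -> vanishes_outside b f -> (forall x, is_derivC F x (f x)) ->
  integral f = (F b - F (- b)%R)%C.
Proof.
move=> Hb Hf Hs HF; rewrite (integralE b f Hb Hf Hs).
apply: (is_RInt_unique (V := C_R_CompleteNormedModule)).
exact: is_RInt_of_primitive.
Qed.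

(** Supplies the primitive to which [integral_of_primitive] is applied for sums and
    complex multiples: linearity of the integral is thereby reduced to that of the
    derivative. *)
Lemma integral_upto_ends (b : R) (f : R -> C) : 0 <= b ->
  smooth f -> vanishes_outside b f ->
  integral_upto f b = integral f /\ integral_upto f (- b) = RtoC 0.
Proof.
move=> Hb Hf Hs; rewrite !(integral_uptoE b f Hb Hf Hs) (integralE b f Hb Hf Hs).
split=> //; exact: (RInt_point (V := C_R_CompleteNormedModule)).
Qed.

Lemma integral_plus (E : space) (xi eta : test E) :
  integral (plus xi eta) = (integral xi + integral eta)%C.
Proof.
have [b [Hb [Hx [He _]]]] :=
  common_bound E xi eta (test_supported xi) (test_supported eta).
have Sx := test_smooth xi; have Se := test_smooth eta.
have [Ex1 Ex2] := integral_upto_ends b xi Hb Sx Hx.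
have [Ee1 Ee2] := integral_upto_ends b eta Hb Se He.
rewrite (integral_of_primitive b
  (fun x => integral_upto xi x + integral_upto eta x)%C) //.
- rewrite Ex1 Ex2 Ee1 Ee2; ring.
- exact: test_smooth.
- by move=> x Hb' /=; rewrite Hx // He // Cplus_0_l.
- move=> x; apply: (is_derive_plus (V := C_R_NormedModule));
    exact: (is_derivC_integral_upto b).
Qed.

Lemma integral_scal (E : space) (c : C) (xi : test E) :
  integral (scal (c : C_Ring) xi) = (c * integral xi)%C.
Proof.
have [b [Hb [Hx _]]] :=
  common_bound E xi xi (test_supported xi) (test_supported xi).
have Sx := test_smooth xi.
have [Ex1 Ex2] := integral_upto_ends b xi Hb Sx Hx.
rewrite (integral_of_primitive b (fun x => c * integral_upto xi x)%C) //.
- rewrite Ex1 Ex2; ring.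
- exact: test_smooth.
- by move=> x Hb' /=; rewrite Hx // Cmult_0_r.
- move=> x; apply: (is_derivC_linear (Cmult c)); first exact: is_linear_Cmult.
  exact: (is_derivC_integral_upto b).
Qed.

Lemma integral_test_deriv (E : space) (xi : test E) : integral (test_deriv xi) = RtoC 0.
Proof.
have [b [Hb [Hx _]]] :=
  common_bound E xi xi (test_supported xi) (test_supported xi).
rewrite (integral_of_primitive (b + 1) xi).
- rewrite !Hx; first ring.
  + rewrite Rabs_left; lra.
  + rewrite Rabs_right; lra.
- lra.
- exact: test_smooth.
- move=> x Hb'; apply: (derivC_local_zero b xi Hx); lra.
- move=> x; exact: smooth_is_derivC (test_smooth xi).
Qed.

(** * Bounds on derivatives and the Poincaré inequality *)

(** The norms of 𝒟_r(ℝ) without the radius: on smooth functions supported in [-r, r] this says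
    that [norm_D r p f <= M] (see [derivatives_bounded_norm_D] and [norm_D_le]). Having no
    radius, it compares functions with different supports. *)
Definition derivatives_bounded (p : nat) (f : R -> C) (M : R) : Prop :=
  forall (q : nat) (x : R), (q <= p)%nat -> Cmod (derivC_n f q x) <= M.

Lemma derivatives_bounded_ge0 (p : nat) (f : R -> C) (M : R) :
  derivatives_bounded p f M -> 0 <= M.
Proof.
move=> H; apply: Rle_trans (Cmod_ge_0 _) (H O 0 _); lia.
Qed.

Lemma derivatives_bounded_plus (p : nat) (f g : R -> C) (M N : R) :
  smooth f -> smooth g -> derivatives_bounded p f M -> derivatives_bounded p g N ->
  derivatives_bounded p (fun x => f x + g x)%C (M + N).
Proof.
move=> Sf Sg Hf Hg q x Hq; rewrite derivC_plus //.
apply: Rle_trans (Cmod_triangle _ _) _.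
by apply: Rplus_le_compat; [exact: Hf | exact: Hg].
Qed.

Lemma derivatives_bounded_scal (p : nat) (c : C) (f : R -> C) (M : R) :
  smooth f -> derivatives_bounded p f M ->
  derivatives_bounded p (fun x => c * f x)%C (Cmod c * M).
Proof.
move=> Sf Hf q x Hq; rewrite derivC_scal // Cmod_mult.
by apply: Rmult_le_compat_l; [exact: Cmod_ge_0 | exact: Hf].
Qed.

Lemma Cmod_le_length_mul (F : R -> C) (u v M : R) : u <= v ->
  smooth F -> (forall x, Cmod (derivC F x) <= M) ->
  Cmod (F v - F u) <= (v - u) * M.
Proof.
move=> Huv HF HM; rewrite Cmod_norm.
apply: (norm_RInt_le_const (V := C_R_NormedModule) (derivC F) u v) => //.
- by move=> x _; rewrite -Cmod_norm.
- apply: is_RInt_of_primitive; first exact: smooth_derivC.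
  move=> x; exact: smooth_is_derivC.
Qed.

(** The function vanishes at - (b + 1), so on [-b, b] it is the integral of its
    derivative over an interval of length at most 2 b + 1. The starting point - b would
    not do here, as vanishing is known only for |x| > b. *)
Lemma poincare (b : R) (p : nat) (F : R -> C) (M : R) : 0 <= b ->
  smooth F -> vanishes_outside b F -> derivatives_bounded p (derivC F) M ->
  derivatives_bounded p F ((2 * b + 1) * M).
Proof.
move=> Hb HF Hs HM; have M0 := derivatives_bounded_ge0 _ _ _ HM.
case=> [|q] x Hq.
- rewrite /=; have [Hx|Hx] := Rlt_le_dec b (Rabs x).
    rewrite Hs // Cmod_0; nra.
  have /Rabs_le_between Hx' := Hx.
  have E0 : F (- (b + 1)) = RtoC 0 by apply: Hs; rewrite Rabs_left; lra.
  have -> : F x = (F x - F (- (b + 1))%R)%C by rewrite E0; ring.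
  apply: Rle_trans (Cmod_le_length_mul F _ x M _ HF _) _; [lra| |nra].
  move=> y; apply: (HM O y); lia.
- rewrite -derivC_n_shift; apply: (Rle_trans _ M); last nra.
  apply: HM; lia.
Qed.

(** The difference has derivative 0, hence is 0 by the Poincaré inequality with M = 0. *)
Lemma test_deriv_inj (E : space) (xi eta : test E) :
  test_deriv xi = test_deriv eta -> xi = eta.
Proof.
move=> H.
have [b [Hb [Hx [He _]]]] :=
  common_bound E xi eta (test_supported xi) (test_supported eta).
have Sx := test_smooth xi; have Se := test_smooth eta.
pose d := fun x => (xi x + (-(1)) * eta x)%C.
have Sd : smooth d by apply: smooth_plus => //; exact: smooth_scal.
have Ed : derivatives_bounded 0 (derivC d) 0.
  move=> q x Hq; have -> : q = O by lia.
  rewrite -[derivC_n _ 0 x]/(derivC_n d 1 x) derivC_plus //; last exact: smooth_scal.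
  rewrite derivC_scal //=.
  have -> : derivC xi x = derivC eta x by rewrite -[LHS]/(test_deriv xi x) H.
  have -> : (derivC eta x + - (1) * derivC eta x = 0)%C by ring.
  rewrite Cmod_0; lra.
have Hd : vanishes_outside b d by move=> x Hb'; rewrite /d Hx // He //; ring.
apply: test_eq => x.
have := poincare b O d 0 Hb Sd Hd Ed O x (Nat.le_refl _); rewrite Rmult_0_r /= => H0.
have E0 : d x = RtoC 0.
  apply: Cmod_eq_0; have := Cmod_ge_0 (d x); lra.
have -> : xi x = (d x + eta x)%C by rewrite /d; ring.
rewrite E0; ring.
Qed.

Lemma integral_bound (b : R) (f : R -> C) (M : R) : 0 <= b ->
  smooth f -> vanishes_outside b f -> (forall x, Cmod (f x) <= M) ->
  Cmod (integral f) <= 2 * b * M.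
Proof.
move=> Hb Hf Hs HM; rewrite Cmod_norm.
have -> : 2 * b * M = (b - - b) * M by ring.
apply: (norm_RInt_le_const (V := C_R_NormedModule) f (- b) b); first lra.
- by move=> x _; rewrite -Cmod_norm.
- rewrite (integralE b f Hb Hf Hs); exact: is_RInt_smooth.
Qed.

(** * Comparison with the norms of 𝒟_r(ℝ) *)

Lemma le_max_derivC (f : R -> C) (p q : nat) (x : R) : (q <= p)%nat ->
  Cmod (derivC_n f q x) <= max_derivC f p x.
Proof.
elim: p => [|p IH] Hq.
  have -> : q = O by lia.
  exact: Rle_refl.
have [->|Hq'] : q = S p \/ (q <= p)%nat by lia.
- exact: Rmax_r.
- exact: Rle_trans (IH Hq') (Rmax_l _ _).
Qed.

Lemma max_derivC_le (f : R -> C) (p : nat) (x M : R) :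
  (forall q, (q <= p)%nat -> Cmod (derivC_n f q x) <= M) -> max_derivC f p x <= M.
Proof.
elim: p => [|p IH] H; first exact: H O (Nat.le_refl _).
by apply: Rmax_lub; [apply: IH => q Hq; apply: H; lia | apply: H; lia].
Qed.

Lemma vanishes_derivC_n (b : R) (f : R -> C) (q : nat) :
  vanishes_outside b f -> vanishes_outside b (derivC_n f q).
Proof. by move=> Hf; elim: q => [|q IH] //; exact: derivC_local_zero. Qed.

Lemma derivatives_bounded_norm_D (r : posreal) (p : nat) (f : R -> C) :
  smooth f -> vanishes_outside r f -> derivatives_bounded p f (norm_D r p f).
Proof.
move=> Sf Hf.
have [Hub _] := norm_D_is_lub r p f Sf.
have H q x : (q <= p)%nat -> Rabs x <= r -> Cmod (derivC_n f q x) <= norm_D r p f.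
  move=> Hq Hx; apply: Rle_trans (le_max_derivC f p q x Hq) _.
  by apply: Hub; exists x.
move=> q x Hq; have [Hx|Hx] := Rlt_le_dec r (Rabs x); last exact: H.
rewrite (vanishes_derivC_n r f q Hf x Hx) Cmod_0.
apply: Rle_trans (Cmod_ge_0 _) (H q 0 Hq _).
rewrite Rabs_R0; have := cond_pos r; lra.
Qed.

Lemma norm_D_le (r : posreal) (p : nat) (f : R -> C) (M : R) :
  smooth f -> derivatives_bounded p f M -> norm_D r p f <= M.
Proof.
move=> Sf HM; have [_ Hl] := norm_D_is_lub r p f Sf.
by apply: Hl => y [x [_ ->]]; apply: max_derivC_le => q Hq; exact: HM.
Qed.

Lemma norm_D_mono (r : posreal) (p q : nat) (xi : test (D_ r)) : (p <= q)%nat ->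
  norm_D r p xi <= norm_D r q xi.
Proof.
move=> Hpq; apply: norm_D_le; first exact: test_smooth.
move=> k x Hk; apply: derivatives_bounded_norm_D; last lia.
- exact: test_smooth.
- exact: (test_supported xi).
Qed.

(** * Neighbourhoods of zero and continuous linear maps *)

(** The radii r of the Fréchet spaces 𝒟_r(ℝ) of which [E] is the inductive limit; this
    is one space when [E] is already 𝒟_a(ℝ). *)
Definition step_radius (E : space) (r : posreal) : Prop :=
  match E with
  | D_ a => r = a
  | Defs.D => exists m, r = radius m
  end.

Lemma step_radius_enlarge (E : space) (r : posreal) (f : R -> C) :
  step_radius E r -> supported E f ->
  exists r', step_radius E r' /\ r <= r' /\ vanishes_outside r' f.
Proof.
case: E => [a|] /=.
- by move=> -> Hf; exists a; split=> //; split=> //; lra.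
- move=> [m ->] [k Hk]; exists (radius (max m k)); split; first by exists (max m k).
  have Hm : radius m <= radius (max m k).
    by apply: Rplus_le_compat_r; apply: le_INR; lia.
  have Hk' : radius k <= radius (max m k).
    by apply: Rplus_le_compat_r; apply: le_INR; lia.
  by split=> // x Hx; apply: Hk; exact: Rle_lt_trans Hk' Hx.
Qed.

Lemma vanishes_outside_le (r r' : R) (f : R -> C) : r <= r' ->
  vanishes_outside r f -> vanishes_outside r' f.
Proof. by move=> Hr Hf x Hx; apply: Hf; lra. Qed.

(** The bound says that T maps each step 𝒟_r(ℝ) continuously into another step, which for
    the strict inductive limit is enough for continuity. Both kinds of space are covered
    by the same condition. *)
Record bounded_linear {E : space} (T : test E -> test E) : Prop := {
  bl_plus : forall xi eta, T (plus xi eta) = plus (T xi) (T eta);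
  bl_scal : forall (c : C_Ring) xi, T (scal c xi) = scal c (T xi);
  bl_bound : forall r, step_radius E r -> exists r', step_radius E r' /\
    (forall xi : test E, vanishes_outside r xi -> vanishes_outside r' (T xi)) /\
    forall p, exists K : posreal, forall (xi : test E) (M : R),
      vanishes_outside r xi -> derivatives_bounded p xi M ->
      derivatives_bounded p (T xi) (K * M)
}.

Arguments bl_plus {E T}.
Arguments bl_scal {E T}.
Arguments bl_bound {E T}.

Lemma nbhs0_impl (E : space) (U V : test E -> Prop) :
  (forall xi, U xi -> V xi) -> nbhs0 E U -> nbhs0 E V.
Proof.
case: E U V => [a|] U V HUV /=.
- by move=> [p [eps H]]; exists p, eps => xi Hxi; apply: HUV; exact: H.
- move=> [W [Hc [Hb [Hn HW]]]]; exists W; do 3 split=> //.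
  by move=> xi Hxi; apply: HUV; exact: HW.
Qed.

Lemma nbhs0_and (E : space) (U V : test E -> Prop) :
  nbhs0 E U -> nbhs0 E V -> nbhs0 E (fun xi => U xi /\ V xi).
Proof.
have trace (r : posreal) (A B : test (D_ r) -> Prop) :
    (exists (p : nat) (eps : posreal), forall xi : test (D_ r), norm_D r p xi < eps -> A xi) ->
    (exists (p : nat) (eps : posreal), forall xi : test (D_ r), norm_D r p xi < eps -> B xi) ->
    exists (p : nat) (eps : posreal), forall xi : test (D_ r),
      norm_D r p xi < eps -> A xi /\ B xi.
  move=> [p [e HA]] [q [d HB]].
  (* The norms increase with their order, so the larger order controls both. *)
  exists (max p q), (mkposreal _ (Rmin_pos e d (cond_pos e) (cond_pos d))) => xi /= H.
  have Hp := norm_D_mono r p (max p q) xi (Nat.le_max_l _ _).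
  have Hq := norm_D_mono r q (max p q) xi (Nat.le_max_r _ _).
  have := Rmin_l e d; have := Rmin_r e d => H1 H2.
  by split; [apply: HA | apply: HB]; lra.
case: E U V => [a|] U V; first exact: trace.
move=> [A [Ac [Ab [An HA]]]] [B [Bc [Bb [Bn HB]]]].
exists (fun xi => A xi /\ B xi); split; [|split; [|split]].
- by move=> xi eta t Ht [H1 H2] [H3 H4]; split; [exact: Ac | exact: Bc].
- by move=> xi c Hc [H1 H2]; split; [exact: Ab | exact: Bb].
- by move=> m; apply: trace.
- by move=> xi [H1 H2]; split; [exact: HA | exact: HB].
Qed.

(** In 𝒟(ℝ) the preimage of a convex balanced set under a linear map is convex and
    balanced, so only the traces on the steps matter; there, as in 𝒟_a(ℝ), the bounds
    on T apply. *)
Lemma nbhs0_preimage (E : space) (T : test E -> test E) (U : test E -> Prop) :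
  bounded_linear T -> nbhs0 E U -> nbhs0 E (fun xi => U (T xi)).
Proof.
move=> HT.
have small r : step_radius E r -> exists r', step_radius E r' /\
    (forall xi : test E, vanishes_outside r xi -> vanishes_outside r' (T xi)) /\
    forall p (eps : posreal), exists delta : posreal, forall xi : test E,
      vanishes_outside r xi -> norm_D r p xi < delta -> norm_D r' p (T xi) < eps.
  move=> Hr; have [r' [Hr' [Hv HK]]] := bl_bound HT r Hr.
  exists r'; split=> //; split=> // p eps; have [K H] := HK p.
  exists (mkposreal _ (Rdiv_lt_0_compat _ _ (cond_pos eps) (cond_pos K))) => xi Hxi /= Hlt.
  have Hb := H xi _ Hxi (derivatives_bounded_norm_D r p xi (test_smooth xi) Hxi).
  apply: Rle_lt_trans (norm_D_le r' p _ _ (test_smooth _) Hb) _.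
  have K0 := cond_pos K.
  have -> : pos eps = K * (eps / K) by field; lra.
  exact: Rmult_lt_compat_l.
case: E T U HT small => [a|] T U HT small /=.
- move=> [p [eps HU]]; have [r' [-> [_ Hs]]] := small a eq_refl.
  have [delta Hd] := Hs p eps.
  by exists p, delta => xi Hxi; apply: HU; apply: Hd => //; exact: (test_supported xi).
- move=> [W [Wc [Wb [Wn HW]]]].
  exists (fun xi => W (T xi)); split; [|split; [|split]].
  + move=> xi eta t Ht H1 H2; rewrite (bl_plus HT) !(bl_scal HT); exact: Wc.
  + by move=> xi c Hc H1; rewrite (bl_scal HT); exact: Wb.
  + move=> m; have [r' [[n Er] [Hv Hs]]] := small (radius m) (ex_intro _ m eq_refl).
    rewrite {}Er in Hv Hs.
    have [p [eps Hp]] := Wn n; have [delta Hd] := Hs p eps.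
    exists p, delta => xi Hxi.
    have Hx : vanishes_outside (radius m) (test_incl m xi) := test_supported xi.
    (* The image is a test function of the step n, and W is small there. *)
    pose eta : test (D_ (radius n)) :=
      @Test (D_ (radius n)) _ (test_smooth (T (test_incl m xi))) (Hv _ Hx).
    have -> : T (test_incl m xi) = test_incl n eta by apply: test_eq.
    by apply: Hp; exact: Hd.
  + by move=> xi; exact: HW.
Qed.

(** * Demi-distributions and the two linear maps *)

(** As T (x + h) = T x + T h, a neighbourhood of T x is pulled back to one of x by
    pulling back a neighbourhood of 0, and the identity for f at T x and T u is the one
    required at x and u. *)
Lemma demi_distribution_comp (E : space) (gamma : C -> C) (U W : test E -> Prop)
    (f : test E -> C) (T : test E -> test E) :
  bounded_linear T -> (forall u, W u -> U (T u)) ->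
  demi_distribution gamma U f -> demi_distribution gamma W (fun xi => f (T xi)).
Proof.
move=> HT HW [Hc [H0 Hd]]; split; [|split].
- move=> xi P HP.
  have H := nbhs0_preimage E T _ HT (Hc (T xi) P HP).
  by apply: nbhs0_impl H => h; rewrite (bl_plus HT).
- have -> : T zero = zero; last exact: H0.
  have := bl_scal HT zero zero; by rewrite !(scal_zero_l (K := C_Ring)).
- move=> x u t Hu Ht; have [r [s H]] := Hd (T x) (T u) t (HW u Hu) Ht.
  by exists r, s; rewrite (bl_plus HT) (bl_scal HT).
Qed.

(** A map of rank one: |∫ xi| <= 2 r M when |xi| <= M on [-r, r]. *)
Lemma bounded_linear_integral_scal (E : space) (xi0 : test E) :
  bounded_linear (fun xi : test E => scal (integral xi : C_Ring) xi0).
Proof.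
split.
- move=> xi eta; rewrite integral_plus; exact: (scal_distr_r (K := C_Ring)).
- move=> c xi; rewrite integral_scal; symmetry; exact: (scal_assoc (K := C_Ring)).
- move=> r Hr.
  have [r' [Hr' [_ H0]]] := step_radius_enlarge E r xi0 Hr (test_supported xi0).
  exists r'; split=> //; split.
    by move=> xi _ x Hx /=; rewrite H0 // Cmult_0_r.
  move=> p; have HN := derivatives_bounded_norm_D r' p xi0 (test_smooth xi0) H0.
  set N := norm_D _ _ _ in HN; have N0 := derivatives_bounded_ge0 _ _ _ HN.
  have r0 := cond_pos r.
  (* N may be 0, while K has to be positive. *)
  have HK : 0 < 2 * r * N + 1 by nra.
  exists (mkposreal _ HK) => xi M Hxi HM q x Hq.
  have M0 := derivatives_bounded_ge0 _ _ _ HM.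
  apply: Rle_trans
    (derivatives_bounded_scal p (integral xi) xi0 N (test_smooth xi0) HN q x Hq) _ => /=.
  have HI : Cmod (integral xi) <= 2 * r * M.
    apply: integral_bound => //; [lra | exact: test_smooth |].
    move=> y; apply: (HM O y); lia.
  apply: (Rle_trans _ (2 * r * M * N)); first exact: Rmult_le_compat_r.
  lra.
Qed.

(** The integrand is put in the form to which the closure of smooth functions under sums
    and multiples applies. *)
Lemma centred_primitiveE (zeta xi : R -> C) (x : R) :
  centred_primitive zeta xi x =
  (- (1) * integral_upto (fun t => xi t + - (integral xi / integral zeta) * zeta t) x)%C.
Proof.
rewrite /centred_primitive -Copp_scal.
congr (- integral_upto _ x)%C; apply: functional_extensionality => t; ring.
Qed.

Lemma vanishes_centred_primitive (E : space) (b : R) (zeta xi : test E) : 0 <= b ->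
  integral zeta <> RtoC 0 -> vanishes_outside b zeta -> vanishes_outside b xi ->
  vanishes_outside b (centred_primitive zeta xi).
Proof.
move=> Hb Hzeta Hz Hxi x Hx; rewrite centred_primitiveE.
rewrite (vanishes_integral_upto b) //; first ring.
- by apply: smooth_plus; [|apply: smooth_scal]; exact: test_smooth.
- by move=> y Hy; rewrite Hxi // Hz //; ring.
- by apply: (integral_centred b) => //; exact: test_smooth.
Qed.

Lemma test_deriv_centred_primitive (E : space) (zeta : test E) (Hzeta : integral zeta <> RtoC 0)
    (xi : test E) :
  test_deriv (centred_primitive_of zeta Hzeta xi) =
  plus (scal (- (1) : C_Ring)%C xi)
       (scal (/ integral zeta : C_Ring)%C (scal (integral xi : C_Ring) zeta)).
Proof.
have [b [Hb [Hxi [Hz _]]]] :=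
  common_bound E xi zeta (test_supported xi) (test_supported zeta).
apply: test_eq => x; apply: is_derivC_unique.
apply: (is_derive_ext (V := C_R_NormedModule)) => [t|].
  by symmetry; exact: centred_primitiveE.
set h := fun _ => _.
have -> : plus (scal (- (1) : C_Ring)%C xi)
    (scal (/ integral zeta : C_Ring)%C (scal (integral xi : C_Ring) zeta)) x =
    (- (1) * h x)%C.
  by rewrite /h /=; field.
apply: (is_derivC_linear (Cmult (- (1)))); first exact: is_linear_Cmult.
apply: (is_derivC_integral_upto b) => //.
- by apply: smooth_plus; [|apply: smooth_scal]; exact: test_smooth.
- by move=> y Hy; rewrite /h Hxi // Hz //; ring.
Qed.

Lemma test_deriv_plus (E : space) (xi eta : test E) :
  test_deriv (plus xi eta) = plus (test_deriv xi) (test_deriv eta).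
Proof.
apply: test_eq => x.
exact: (f_equal (fun F => F x) (derivC_plus xi eta (test_smooth xi) (test_smooth eta) 1)).
Qed.

Lemma test_deriv_scal (E : space) (c : C_Ring) (xi : test E) :
  test_deriv (scal c xi) = scal c (test_deriv xi).
Proof.
apply: test_eq => x.
exact: (f_equal (fun F => F x) (derivC_scal c xi (test_smooth xi) 1)).
Qed.

(** By the Poincaré inequality, it is enough to bound the derivative of the centred
    primitive, which is built from the identity and the rank one map
    xi ↦ (∫ xi) zeta. *)
Lemma bounded_linear_centred_primitive (E : space) (zeta : test E)
    (Hzeta : integral zeta <> RtoC 0) : bounded_linear (centred_primitive_of zeta Hzeta).
Proof.
split.
- move=> xi eta; apply: test_deriv_inj.
  rewrite test_deriv_plus !test_deriv_centred_primitive integral_plus.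
  apply: test_eq => x /=; field; exact: Hzeta.
- move=> c xi; apply: test_deriv_inj.
  rewrite test_deriv_scal !test_deriv_centred_primitive integral_scal.
  apply: test_eq => x /=; field; exact: Hzeta.
- move=> r Hr.
  have [r' [Hr' [Hle Hz]]] := step_radius_enlarge E r zeta Hr (test_supported zeta).
  have r0 := cond_pos r'.
  exists r'; split=> //; split.
    move=> xi Hxi; apply: vanishes_centred_primitive => //; first lra.
    exact: vanishes_outside_le Hxi.
  move=> p.
  have [_ [_ [_ HT1]]] := bl_bound (bounded_linear_integral_scal E zeta) r Hr.
  have {HT1} [K HK] := HT1 p.
  set c := (/ integral zeta)%C.
  have K0 := cond_pos K; have c0 := Cmod_ge_0 c.
  have Hpos : 0 < (2 * r' + 1) * (1 + Cmod c * K) by apply: Rmult_lt_0_compat; nra.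
  exists (mkposreal _ Hpos) => xi M Hxi HM.
  have -> : mkposreal _ Hpos * M = (2 * r' + 1) * (Cmod (- (1))%C * M + Cmod c * (K * M)).
    by rewrite Cmod_opp Cmod_1 /=; ring.
  apply: poincare; first lra.
  + exact: test_smooth.
  + apply: vanishes_centred_primitive => //; first lra.
    exact: vanishes_outside_le Hxi.
  + rewrite -[derivC _]/(test_fun E (test_deriv (centred_primitive_of zeta Hzeta xi))).
    rewrite test_deriv_centred_primitive.
    apply: derivatives_bounded_plus; try exact: test_smooth.
    * by apply: derivatives_bounded_scal; first exact: test_smooth.
    * apply: derivatives_bounded_scal; first exact: test_smooth.
      exact: HK.
Qed.

Theorem theorem2p7 (E : space) (U : test E -> Prop) (gamma : C -> C) (f : test E -> C)
    (HU : nbhs0 E U) (Hgamma : C0 gamma) (Hf : demi_distribution gamma U f)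
    (xi0 : test E) (f0 : test E -> C) (Hf0 : demi_distribution gamma U f0)
    (zeta : test E) (Hzeta : integral zeta <> RtoC 0)
    (g : test E -> C)
    (Hg : forall xi : test E,
      g xi = Cplus (f0 (scal (integral xi : C_Ring) xi0))
                   (f (centred_primitive_of zeta Hzeta xi))) :
  (exists W : test E -> Prop,
     nbhs0 E W /\ linear_span (demi_distribution gamma W) g) /\
  derivative g = f.
Proof.
have HT1 := bounded_linear_integral_scal E xi0.
have HT2 := bounded_linear_centred_primitive E zeta Hzeta.
set T1 := (fun xi => _) in HT1; set T2 := centred_primitive_of _ _ in HT2.
split.
- exists (fun xi => U (T1 xi) /\ U (T2 xi)); split.
    by apply: nbhs0_and; exact: nbhs0_preimage.
  exists ((RtoC 1, fun xi => f0 (T1 xi)) :: (RtoC 1, fun xi => f (T2 xi)) :: nil)%list.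
  split.
  + apply: Forall_cons; [|apply: Forall_cons; last exact: Forall_nil] => /=.
    * by apply: (demi_distribution_comp E gamma U _ f0 T1 HT1) => // u [].
    * by apply: (demi_distribution_comp E gamma U _ f T2 HT2) => // u [].
  + move=> xi; rewrite Hg /= !Cmult_1_l Cplus_0_r; reflexivity.
- apply: functional_extensionality => xi; rewrite /derivative Hg.
  have -> : opp (test_deriv xi) = scal (- (1) : C_Ring)%C (test_deriv xi).
    by apply: test_eq => x /=; ring.
  have E0 : integral (scal (- (1) : C_Ring)%C (test_deriv xi)) = RtoC 0.
    by rewrite integral_scal integral_test_deriv Cmult_0_r.
  rewrite E0 (scal_zero_l (K := C_Ring)) (proj1 (proj2 Hf0)) Cplus_0_l.
  congr f; apply: test_deriv_inj; rewrite test_deriv_centred_primitive E0.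
  apply: test_eq => x /=; field; exact: Hzeta.
Qed.
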